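(* Let $m \ge 5$ be odd and $n = 3^m-1$. Then the ternary cyclic code $\mathcal{C}_{(0,3,m)}$ has parameters $[n,k,d]$ with $d \ge \frac{3^{(m-1)/2}+7}{2}$ if $m \equiv 3 \pmod 4$ and $d \ge \frac{3^{(m-1)/2}+5}{2}$ if $m \equiv 1 \pmod 4$, and $k = \frac{n}{2}$ if $m \equiv 3 \pmod 4$ and $k = \frac{n+2}{2}$ if $m \equiv 1 \pmod 4$.
   Context: Let $m \ge 2$ be an integer, $n = 3^m-1$, and let $\alpha$ be a primitive element of $\mathbb{F}_{3^m}$. For an integer $0 \le j \le n-1$ with $3$-adic expansion $j = \sum_{t=0}^{m-1} j_t 3^t$, $j_t \in \{0,1,2\}$, let $w_3(j) = \sum_{t=0}^{m-1} j_t$. For distinct $i_1, i_2 \in \{0,1,2,3\}$ let $T_{(i_1,i_2,m)} = \{1 \le j \le n-1 : w_3(j) \equiv i_1 \text{ or } i_2 \pmod 4\}$ and $g_{(i_1,i_2,m)}(x) = \prod_{j \in T_{(i_1,i_2,m)}} (x - \alpha^j) \in \mathbb{F}_3[x]$. $\mathcal{C}_{(i_1,i_2,m)}$ denotes the ternary cyclic code of length $n$ with generator polynomial $g_{(i_1,i_2,m)}(x)$. Parameters $[n,k,d]$ mean length, dimension over $\mathbb{F}_3$, and minimum Hamming distance. *)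

(* Defs.v *)
From HB Require Import structures.
From mathcomp Require Import all_boot all_order all_algebra all_field.
Set Implicit Arguments. Unset Strict Implicit. Unset Printing Implicit Defensive.
Import GRing.Theory.
Local Open Scope ring_scope.

Definition w3 (m j : nat) : nat := (\sum_(t < m) (j %/ 3 ^ t) %% 3)%N.

Definition Tset (i1 i2 m : nat) : seq nat :=
  [seq j <- iota 1 (3 ^ m - 2)
     | (w3 m j %% 4 == i1)%N || (w3 m j %% 4 == i2)%N].

Definition gen_poly (L : fieldType) (alpha : L) (i1 i2 m : nat) : {poly L} :=
  \prod_(j <- Tset i1 i2 m) ('X - (alpha ^+ j)%:P).

(* embedding of F_3 into a field L (of characteristic 3) *)
Definition F3_to (L : fieldType) (a : 'F_3) : L := (val a)%:R.

Definition word_poly (L : fieldType) (n : nat) (c : 'rV['F_3]_n) : {poly L} :=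
  \sum_(i < n) F3_to L (c 0 i) *: 'X^i.

(* the cyclic code of length n = 3^m - 1 with generator polynomial g:
   words whose polynomial is a multiple of g (g divides x^n - 1) *)
Definition cyc_code (L : fieldType) (alpha : L) (i1 i2 m : nat)
  : {set 'rV['F_3]_(3 ^ m - 1)} :=
  [set c | gen_poly alpha i1 i2 m %| word_poly L c].

Definition wt (n : nat) (c : 'rV['F_3]_n) : nat := #|[set i | c 0 i != 0]|.

Definition code_dim (n : nat) (C : {set 'rV['F_3]_n}) : nat :=
  \dim <<enum C>>%VS.

(* minimum Hamming distance = minimum weight of a nonzero codeword
   (default n if there is none) *)
Definition min_dist (n : nat) (C : {set 'rV['F_3]_n}) : nat :=
  \big[minn/n]_(c in C | c != 0) wt c.

(* Main.v *)
(* Minimum distance: the BCH bound applied to [beta = alpha ^+ v], where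
   v = n/2 + 3^h + 1 if m = 1 mod 4, and v = n/2 + 3^(h+1) - 1 if m = 3 mod 4,
   with m = 2h+1.  For even i the term n/2 disappears from v i mod n, and for odd
   i it contributes the number 1...1 in base 3; as long as i does not exceed
   (3^h-1)/2 the base 3 digits of v i mod n split into two blocks that are equal
   (first case) or complementary (second case), so that the digit sum is known
   mod 4; the last few values of i are treated by hand.
   Dimension: the set of zeros is stable under multiplication by 3, so the generator
   polynomial has coefficients in F_3 and k = n - #|T|; #|T| follows from a recursion
   in m with step 2 on the number of j < 3^m with digit sum 0 or 3 mod 4. *)

Require Import Defs.
From HB Require Import structures.
From mathcomp Require Import all_boot all_order all_algebra all_field.
From mathcomp Require Import zify ring.
Set Implicit Arguments. Unset Strict Implicit. Unset Printing Implicit Defensive.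
Import GRing.Theory.

Local Open Scope nat_scope.

(** * Base 3 digit sums: concatenation, complement, parity and rotation *)

Lemma w3_cat p q a b :
  a < 3 ^ p -> w3 (p + q) (a + 3 ^ p * b) = w3 p a + w3 q b.
Proof.
move=> lta; rewrite /w3 big_split_ord /=; congr (_ + _); apply: eq_bigr => t _.
  (* For t < p this term is a multiple of 3 * 3^t, so it does not affect digit t. *)
  have -> : 3 ^ p * b = 3 ^ (p - t).-1 * b * 3 * 3 ^ t.
    have lt_tp := ltn_ord t.
    rewrite -[in LHS](subnK (ltnW lt_tp)) expnD -[p - t in LHS]prednK ?subn_gt0 //.
    rewrite expnS; nia.
  by rewrite divnDMl ?expn_gt0 // addnC modnMDl.
by rewrite expnD divnMA [3 ^ p * b]mulnC divnDMl ?expn_gt0 // [a %/ _]divn_small.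
Qed.

Lemma w3_0 p : w3 p 0 = 0.
Proof. by rewrite /w3 big1 // => t _; rewrite div0n. Qed.

Lemma w3_digit a : a < 3 -> w3 1 a = a.
Proof. by move=> lta; rewrite /w3 big_ord1 expn0 divn1 modn_small. Qed.

Lemma w3_digits p r q : r < 3 -> w3 p.+1 (r + 3 * q) = r + w3 p q.
Proof. by move=> ltr; rewrite -add1n -{1}[3]expn1 w3_cat // w3_digit. Qed.

Lemma w3_1 p : 0 < p -> w3 p 1 = 1.
Proof. by case: p => // p _; rewrite -[1]/(1 + 3 * 0) w3_digits // w3_0. Qed.

Lemma w3_widen p q a : a < 3 ^ p -> w3 (p + q) a = w3 p a.
Proof. by move=> lta; rewrite -[a in LHS]addn0 -(muln0 (3 ^ p)) w3_cat // w3_0 addn0. Qed.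

(** Subtracting from 22...2 needs no borrow: each digit x becomes 2 - x. *)
Lemma w3_compl p a : a < 3 ^ p -> w3 p (3 ^ p - 1 - a) + w3 p a = p.*2.
Proof.
elim: p a => [|p IH] a lta; first by rewrite /w3 !big_ord0.
rewrite expnS in lta *; have ltq : a %/ 3 < 3 ^ p by lia.
have -> : 3 * 3 ^ p - 1 - a = (2 - a %% 3) + 3 * (3 ^ p - 1 - a %/ 3) by lia.
rewrite [X in _ + w3 _ X](_ : a = a %% 3 + 3 * (a %/ 3)); last by lia.
rewrite !w3_digits; [|lia..].
by have := IH _ ltq; lia.
Qed.

(** Powers of 3 are odd. The parity of a thus determines 2 * [w3 p a] mod 4, the form needed when a
    block of digits occurs twice. *)
Lemma odd_w3 p a : a < 3 ^ p -> odd (w3 p a) = odd a.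
Proof.
elim: p a => [|p IH] a lta; first by rewrite /w3 big_ord0; case: a lta.
rewrite expnS in lta; have ltq : a %/ 3 < 3 ^ p by lia.
rewrite (_ : a = a %% 3 + 3 * (a %/ 3)); last by lia.
by rewrite w3_digits ?ltn_mod //; have := IH _ ltq; lia.
Qed.

(** Modulo 3^(p+1) - 1, multiplication by 3 moves the leading digit b to the units place. *)
Lemma w3_rot p j : j < 3 ^ p.+1 - 1 ->
  w3 p.+1 (3 * j %% (3 ^ p.+1 - 1)) = w3 p.+1 j.
Proof.
move=> ltj; have X0 : 0 < 3 ^ p by rewrite expn_gt0.
set a := j %% 3 ^ p; set b := j %/ 3 ^ p.
have jE : j = a + 3 ^ p * b by rewrite {1}(divn_eq j (3 ^ p)) addnC mulnC.
have lta : a < 3 ^ p by rewrite ltn_mod.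
have ltb : b < 3 by rewrite ltn_divLR // -expnS; lia.
rewrite [in RHS]jE -addn1 w3_cat // w3_digit //.
have -> : 3 * j %% (3 ^ (p + 1) - 1) = b + 3 * a.
  rewrite addn1 expnS in ltj *.
  have -> : 3 * j = b * (3 * 3 ^ p - 1) + (b + 3 * a) by rewrite jE; nia.
  by rewrite modnMDl modn_small //; nia.
by rewrite addn1 w3_digits // addnC.
Qed.

(** * The number of exponents with digit sum 0 or 3 mod 4 *)

Lemma sum_mul3 (F : nat -> nat) N :
  \sum_(j < 3 * N) F j = \sum_(j < N) (F (3 * j) + F (1 + 3 * j) + F (2 + 3 * j)).
Proof.
elim: N => [|N IH]; first by rewrite muln0 !big_ord0.
rewrite mulnS !addSn add0n !big_ord_recr /= IH.
by rewrite add1n add2n -!addnA.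
Qed.

Definition w03 m j := (w3 m j %% 4 == 0) || (w3 m j %% 4 == 3).

Lemma mem_Tset m j : (j \in Tset 0 3 m) = (0 < j < 3 ^ m - 1) && w03 m j.
Proof.
rewrite mem_filter mem_iota andbC; congr (_ && _); case: j => //= j.
have : 0 < 3 ^ m by rewrite expn_gt0.
by lia.
Qed.

(* Of the nine ways to add two digits to j, four give a digit sum 0 or 3 mod 4 if
   w3 m j is itself 0 or 3 mod 4, and five otherwise. *)
Lemma sum_w03SS m :
  \sum_(j < 3 ^ m.+2) w03 m.+2 j + \sum_(j < 3 ^ m) w03 m j = 5 * 3 ^ m.
Proof.
rewrite !expnS (sum_mul3 (fun j => w03 m.+2 j : nat)).
rewrite (sum_mul3 (fun j =>
  w03 m.+2 (3 * j) + w03 m.+2 (1 + 3 * j) + w03 m.+2 (2 + 3 * j))).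
rewrite -big_split /= (eq_bigr (fun=> 5)); first by rewrite sum_nat_const card_ord mulnC.
move=> j _; rewrite /w03.
have w a b : a < 3 -> b < 3 -> w3 m.+2 (a + 3 * (b + 3 * j)) = a + (b + w3 m j).
  by move=> lta ltb; rewrite !w3_digits.
have w0 b : b < 3 -> w3 m.+2 (3 * (b + 3 * j)) = b + w3 m j by move/(w 0 b isT).
have w00 : w3 m.+2 (3 * (3 * j)) = w3 m j by exact: (w 0 0).
have wa a : a < 3 -> w3 m.+2 (a + 3 * (3 * j)) = a + w3 m j by move/(w a 0)->.
rewrite !w ?w0 ?w00 ?wa //; set x := w3 m j.
rewrite (divn_eq x 4) ; have : x %% 4 < 4 by rewrite ltn_mod.
by case: (x %% 4) => [|[|[|[|]]]] // _; rewrite !(addnCA _ (_ * 4)) !modnMDl.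
Qed.

(** Of the two endpoints excluded from T, only j = 0 is counted on the right: 3^m - 1 has digit sum
    2m, which is 2 mod 4 for odd m. *)
Lemma size_Tset m :
  0 < m -> odd m -> (size (Tset 0 3 m)).+1 = \sum_(j < 3 ^ m) w03 m j.
Proof.
move=> m0 om; have X0 : 1 < 3 ^ m by rewrite (ltn_exp2l 0).
rewrite size_filter -sum1_count -(big_mkord xpredT (fun j => w03 m j : nat)) /=.
have -> : 3 ^ m = (3 ^ m - 2).+2 by lia.
rewrite big_nat_recr //= big_nat_recl //= !subn2 /=.
rewrite {1}/w03 w3_0 /= add1n addSn; congr _.+1.
have -> : w03 m (3 ^ m).-2.+1 = false.
  have := w3_compl (a := 0) (ltnW X0); rewrite w3_0 addn0 subn0 /w03.
  by rewrite (_ : (3 ^ m).-2.+1 = 3 ^ m - 1); [move=> -> |]; lia.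
rewrite /= addn0 big_mkcond /= /index_iota subn0 -[1]addn0 iotaDl big_map.
by apply: eq_bigr => j _; rewrite add1n /w03; case: (_ || _).
Qed.

(** With S(m) the full count, two recursion steps give S(m+4) = S(m) + 40 * 3^m, while 3^(m+4) = 3^m
    + 80 * 3^m. So 2 S(m) - 3^m depends only on m mod 4, and m = 1 and m = 3 decide. *)
Lemma size_Tset_mod4 k r : r = 1 \/ r = 3 ->
  (size (Tset 0 3 (4 * k + r))).*2 + (if r == 1 then 3 else 1) = 3 ^ (4 * k + r).
Proof.
move=> hr.
suff IH : (\sum_(j < 3 ^ (4 * k + r)) w03 (4 * k + r) j).*2 + (r == 1)
         = 3 ^ (4 * k + r) + (r == 3).
  by rewrite -size_Tset in IH; [case: hr IH => -> /=; lia | case: hr => ->; lia..].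
elim: k => [|k IH].
  have S1 : \sum_(j < 3 ^ 1) w03 1 j = 1.
    by rewrite !big_ord_recr big_ord0 /= /w03 !w3_digit.
  case: hr => ->; rewrite muln0 add0n; first by rewrite S1.
  by have := sum_w03SS 1; rewrite S1; lia.
have e4 : 4 * k.+1 + r = (4 * k + r).+4 by lia.
rewrite e4; set m := 4 * k + r in IH *.
by have := sum_w03SS m; have := sum_w03SS m.+2; rewrite !expnS; lia.
Qed.

(** * Runs of consecutive multiples of v inside T *)

Lemma expn3_double k : exists q, 3 ^ k.*2 = 8 * q + 1.
Proof.
elim: k => [|k [q IH]]; first by exists 0.
by exists (9 * q + 1); rewrite doubleS !expnS IH; lia.
Qed.

Lemma odd_expn3 p : odd (3 ^ p).
Proof. by rewrite oddX orbT. Qed.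

Lemma half_expn3 m : 3 ^ m = (3 ^ m - 1) %/ 2 * 2 + 1.
Proof. by have := odd_expn3 m; lia. Qed.

(** A common divisor d is odd and divides n = 2 (n/2), hence n/2, hence c; so d divides 2 and is
    1. *)
Lemma coprime_step m c :
  odd ((3 ^ m - 1) %/ 2 + c) ->
  (forall d, d %| 3 ^ m - 1 -> d %| c -> d %| 2) ->
  coprime ((3 ^ m - 1) %/ 2 + c) (3 ^ m - 1).
Proof.
move=> ov hd; rewrite /coprime; set d := gcdn _ _.
have dv : d %| (3 ^ m - 1) %/ 2 + c by apply: dvdn_gcdl.
have dn : d %| 3 ^ m - 1 by apply: dvdn_gcdr.
have od : odd d by apply: dvdn_odd dv ov.
have cd2 : coprime d 2 by rewrite coprimen2.
have nE : 3 ^ m - 1 = (3 ^ m - 1) %/ 2 * 2 by have := half_expn3 m; lia.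
have dB : d %| (3 ^ m - 1) %/ 2 by rewrite nE Gauss_dvdl // in dn.
have dc : d %| c by rewrite dvdn_addr // in dv.
by have := gcdn_idPl (hd d dn dc); rewrite (eqnP cd2) => <-.
Qed.

(** Modulo n, i * (n/2) is n/2 or 0 according to the parity of i; k counts the further multiples of
    n to remove. *)
Lemma modn_step m c i k j :
  odd i * ((3 ^ m - 1) %/ 2) + c * i = k * (3 ^ m - 1) + j -> j < 3 ^ m - 1 ->
  ((3 ^ m - 1) %/ 2 + c) * i %% (3 ^ m - 1) = j.
Proof.
move=> e ltj; have := half_expn3 m; set B := _ %/ 2 in e * => nB.
have -> : (B + c) * i = (i./2 + k) * (3 ^ m - 1) + j.
  rewrite mulnDl mulnDl -addnA -e -{1}(odd_double_half i) nB addnK.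
  by rewrite mulnDr -muln2 addnC [_ * (B * 2)]mulnC; lia.
by rewrite modnMDl modn_small.
Qed.

Lemma run_mod4_1 h : ~~ odd h -> 0 < h ->
  let m := h.*2.+1 in let v := (3 ^ m - 1) %/ 2 + (3 ^ h + 1) in
  coprime v (3 ^ m - 1) /\
  (forall i, 0 < i <= (3 ^ h + 3) %/ 2 -> v * i %% (3 ^ m - 1) \in Tset 0 3 m).
Proof.
move=> eh h0 m v.
(* Here 4q = (3^h - 1)/2 is the number with h digits 1. *)
have [q Eq] := expn3_double h./2; rewrite even_halfK // in Eq.
have Em : 3 ^ m = 3 * (3 ^ h * 3 ^ h) by rewrite /m expnS -addnn expnD.
have mE : m = h + (h + 1) by rewrite /m; lia.
have X9 : 9 <= 3 ^ h by rewrite -[9]/(3 ^ 2) leq_exp2l //; lia.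
have nB := half_expn3 m.
have qX : 3 ^ h * 3 ^ h = 8 * (q * 3 ^ h) + 3 ^ h by rewrite {1}Eq; ring.
have XX9 : 9 * 3 ^ h <= 3 ^ h * 3 ^ h by rewrite leq_mul2r X9 orbT.
split.
  apply: coprime_step; first by rewrite Em in nB *; lia.
  move=> d dn dc.
  have e : 3 * (3 ^ h + 1) * (3 ^ h - 1) + 2 = 3 ^ m - 1.
    rewrite Em mulnBr muln1.
    by rewrite (_ : 3 * (3 ^ h + 1) * 3 ^ h = 3 * (3 ^ h * 3 ^ h) + 3 * 3 ^ h); [lia | ring].
  by rewrite -e dvdn_addr // in dn; rewrite dvdn_mulr // dvdn_mull.
move=> i /andP[i0 lei].
have Xi : 2 * (3 ^ h * i) <= 3 ^ h * (3 ^ h + 3) by rewrite mulnCA leq_mul2l; lia.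
have lti : i < 3 ^ h by lia.
have [oi|ei] := boolP (odd i); last first.
  rewrite (@modn_step m _ i 0 (i + 3 ^ h * i)); first last.
  - by rewrite Em; lia.
  - by rewrite (negPf ei); lia.
  (* Two copies of the even number i: the digit sum 2 w3(i) is 0 mod 4. *)
  rewrite mem_Tset; apply/andP; split; first by rewrite Em; lia.
  rewrite /w03 mE w3_cat // w3_widen //.
  by have := odd_w3 lti; lia.
rewrite (@modn_step m _ i 0 ((3 ^ m - 1) %/ 2 + (3 ^ h + 1) * i)); first last.
- by rewrite Em in nB *; lia.
- by rewrite oi mul1n.
rewrite mem_Tset; apply/andP; split; first by rewrite Em in nB *; lia.
(* While i <= 4q, adding i to a block 1...1 does not overflow. Two copies of the odd number 4q + i
   and a leading digit 1 give a sum that is 3 mod 4. *)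
rewrite /w03; have [lei'|] := leqP i (4 * q).
  have lt_s : 4 * q + i < 3 ^ h by lia.
  have -> : (3 ^ m - 1) %/ 2 + (3 ^ h + 1) * i
          = (4 * q + i) + 3 ^ h * ((4 * q + i) + 3 ^ h * 1).
    by rewrite Em in nB *; lia.
  rewrite mE !w3_cat // w3_digit //.
  by have := odd_w3 lt_s; lia.
(* Only i = 4q + 1 is left: both blocks overflow, leaving the digits 1 and 2. *)
move=> lt_i; have {lt_i lei}iE : i = 4 * q + 1 by lia.
have -> : (3 ^ m - 1) %/ 2 + (3 ^ h + 1) * i = 0 + 3 ^ h * (1 + 3 ^ h * 2).
  by rewrite iE; rewrite Em in nB *; lia.
rewrite mE !w3_cat ?expn_gt0 //; last by lia.
by rewrite w3_0 w3_1 // w3_digit.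
Qed.

Lemma run_mod4_3 h : odd h -> 1 < h ->
  let m := h.*2.+1 in let v := (3 ^ m - 1) %/ 2 + (3 ^ h.+1 - 1) in
  coprime v (3 ^ m - 1) /\
  (forall i, 0 < i <= (3 ^ h + 5) %/ 2 -> v * i %% (3 ^ m - 1) \in Tset 0 3 m).
Proof.
move=> oh h1 m v.
have [q Eq'] := expn3_double h./2.
(* Here 12q + 1 = (3^h - 1)/2 is the number with h digits 1. *)
have Eq : 3 ^ h = 24 * q + 3.
  by rewrite -[h in LHS]odd_double_half oh add1n expnS Eq'; lia.
have Em : 3 ^ m = 3 * (3 ^ h * 3 ^ h) by rewrite /m expnS -addnn expnD.
have mE : m = (h + 1) + h by rewrite /m; lia.
have Eh1 : 3 ^ (h + 1) = 3 * 3 ^ h by rewrite addn1 expnS.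
have X27 : 27 <= 3 ^ h by rewrite -[27]/(3 ^ 3) leq_exp2l //; lia.
have nB := half_expn3 m.
have qX : 3 ^ h * 3 ^ h = 24 * (q * 3 ^ h) + 3 * 3 ^ h by rewrite {1}Eq; ring.
have XX : 27 * 3 ^ h <= 3 ^ h * 3 ^ h by rewrite leq_mul2r X27 orbT.
rewrite {}/v -[h.+1]addn1; split.
  apply: coprime_step; first by rewrite Eh1; rewrite Em in nB *; lia.
  move=> d dn dc.
  have e : (3 ^ (h + 1) - 1) * (3 ^ (h + 1) + 1) = 3 * (3 ^ m - 1) + 2.
    rewrite Em Eh1 mulnDr muln1 mulnBl mul1n.
    by rewrite (_ : 3 * 3 ^ h * (3 * 3 ^ h) = 9 * (3 ^ h * 3 ^ h)); [lia | ring].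
  have : d %| (3 ^ (h + 1) - 1) * (3 ^ (h + 1) + 1) by rewrite dvdn_mulr.
  by rewrite e dvdn_addr // dvdn_mull.
move=> i /andP[i0 lei].
have Xi : 2 * (3 ^ h * i) <= 3 ^ h * (3 ^ h + 5) by rewrite mulnCA leq_mul2l; lia.
have Xi0 : 3 ^ h <= 3 ^ h * i by rewrite leq_pmulr.
have ci : (3 ^ (h + 1) - 1) * i = 3 * (3 ^ h * i) - i by rewrite Eh1 mulnBl mul1n mulnA.
have lti : i < 3 ^ h by lia.
have [oi|ei] := boolP (odd i); last first.
  (* The upper block is i - 1, the lower one its complement on h + 1 digits: the sum is 2(h + 1),
     which is 0 mod 4 for odd h. *)
  have e : 3 ^ (h + 1) * (i - 1) = 3 * (3 ^ h * i) - 3 * 3 ^ h.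
    by rewrite Eh1 mulnBr muln1 mulnA.
  rewrite (@modn_step m _ i 0 ((3 ^ (h + 1) - 1 - (i - 1)) + 3 ^ (h + 1) * (i - 1)));
    first last.
  - by rewrite e Em Eh1; lia.
  - by rewrite (negPf ei) e ci Eh1; lia.
  rewrite mem_Tset; apply/andP; split; first by rewrite e Em Eh1; lia.
  have lti1 : i - 1 < 3 ^ h by lia.
  have lti' : i - 1 < 3 ^ (h + 1) by lia.
  rewrite /w03 mE w3_cat //; last by lia.
  by have := w3_compl lti'; rewrite (w3_widen 1 lti1); lia.
rewrite mem_Tset /w03; have [lei'|] := leqP i (12 * q + 1).
  (* Now s = 12q + 1 + i and its complement on h digits surround a digit 1: the sum is 2h + 1, which
     is 3 mod 4. *)
  have lt_s : 12 * q + 1 + i < 3 ^ h by lia.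
  have [s sE] : exists s, s = 12 * q + 1 + i by exists (12 * q + 1 + i).
  rewrite -sE in lt_s.
  have e : 3 ^ (h + 1) * s = 36 * (q * 3 ^ h) + 3 * 3 ^ h + 3 * (3 ^ h * i).
    by rewrite Eh1 sE; ring.
  have Xi' : 3 ^ h * (2 * i + 1) <= 3 ^ h * 3 ^ h by rewrite leq_mul2l; lia.
  rewrite (@modn_step m _ i 0 (((3 ^ h - 1 - s) + 3 ^ h * 1) + 3 ^ (h + 1) * s)); first last.
  - by rewrite e Em; lia.
  - by rewrite oi e ci; rewrite Em in nB *; lia.
  apply/andP; split; first by rewrite e Em; lia.
  rewrite mE w3_cat //; last by lia.
  rewrite w3_cat // ?w3_digit //; last by lia.
  by have := w3_compl lt_s; lia.
(* The only odd value left passes n once, hence k = 1 below; the digits are a 1 followed by 0 and h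
   digits 2. *)
move=> lt_i; have {lt_i lei}iE : i = 12 * q + 3 by lia.
rewrite (@modn_step m _ i 1 ((3 ^ h - 1) + 3 ^ (h + 1) * 1)); first last.
- by rewrite Em Eh1; lia.
- have e : 3 ^ h * i = 12 * (q * 3 ^ h) + 3 * 3 ^ h by rewrite iE; ring.
  by rewrite oi ci e Eh1; rewrite Em in nB *; lia.
apply/andP; split; first by rewrite Em Eh1; lia.
rewrite mE w3_cat //; last by lia.
rewrite w3_widen ?w3_1 //; [|lia..].
have := w3_compl (a := 0) (p := h); rewrite w3_0 expn_gt0 subn0 => /(_ isT).
by lia.
Qed.

(** * The BCH bound, and counting codewords over a finite field *)

Local Open Scope ring_scope.

(* If the support S had at most d elements, the power sums could be combined into
   the evaluation against prod_(k in S \ k0) (X - beta^k), isolating c k0. *)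
Lemma bch_bound (L : fieldType) (n d : nat) (beta : L) (c : 'I_n -> L) :
  n.-primitive_root beta ->
  (forall i, (0 < i <= d)%N -> \sum_(k < n) c k * beta ^+ (i * k) = 0) ->
  (exists k, c k != 0) -> (d < #|[set k | c k != 0%R]|)%N.
Proof.
move=> prim_beta roots_c [k0 ck0]; rewrite ltnNge; apply/negP => le_d.
set S := [set k | c k != 0] in le_d.
have Sk0 : k0 \in S by rewrite inE.
have beta0 : beta != 0.
  by rewrite (prim_root_eq0 prim_beta) -lt0n (prim_order_gt0 prim_beta).
pose p := \prod_(k <- enum (S :\ k0)) ('X - (beta ^+ k)%:P).
have size_p : (size p <= d)%N.
  by rewrite size_prod_XsubC -cardE; move: le_d; rewrite (cardsD1 k0) Sk0.
(* The extra factor [beta ^+ k] is there because the vanishing power sums start at i = 1. *)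
have : \sum_(k < n) c k * beta ^+ k * p.[beta ^+ k] = 0.
  transitivity (\sum_(i < size p) p`_i * \sum_(k < n) c k * beta ^+ (i.+1 * k)).
    rewrite (eq_bigr (fun k : 'I_n =>
      \sum_(i < size p) p`_i * (c k * beta ^+ (i.+1 * k)))) => [|k _].
      by rewrite exchange_big; apply: eq_bigr => i _; rewrite mulr_sumr.
    rewrite horner_coef mulr_sumr; apply: eq_bigr => i _.
    by rewrite -exprM mulSn exprD [(i * k)%N]mulnC mulrCA !mulrA.
  by apply: big1 => i _; rewrite roots_c ?mulr0 // (leq_trans _ size_p) ?ltn_ord.
rewrite (bigD1 k0) //= big1 ?addr0 => [|k nk].
  apply/eqP; rewrite !mulf_neq0 ?expf_neq0 //.
  rewrite -[_ != 0]/(~~ root p _) /p.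
  rewrite -(big_map (fun k : 'I_n => beta ^+ k) xpredT (fun z => 'X - z%:P)).
  rewrite root_prod_XsubC; apply/mapP => -[k]; rewrite mem_enum !inE => /andP[nk _].
  move/eqP; rewrite (eq_prim_root_expr prim_beta) !modn_small // => /eqP/val_inj e.
  by rewrite e eqxx in nk.
have [/eqP->|ck] := boolP (c k == 0); first by rewrite !mul0r.
suff /rootP-> : root p (beta ^+ k) by rewrite mulr0.
rewrite /p -(big_map (fun k : 'I_n => beta ^+ k) xpredT (fun z => 'X - z%:P)).
by rewrite root_prod_XsubC; apply/mapP; exists k => //; rewrite mem_enum !inE nk.
Qed.

(** A linear set equals its span, so its dimension can be found by counting. *)
Lemma card_span (F : finFieldType) n (C : {set 'rV[F]_n}) :
  0 \in C -> (forall a u v, u \in C -> v \in C -> a *: u + v \in C) ->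
  #|<<enum C>>%VS| = #|C|.
Proof.
move=> C0 CL; apply: eq_card => v; apply/idP/idP; last first.
  by move=> Cv; apply: memv_span; rewrite mem_enum.
move/coord_span->; elim/big_ind: _ => // [u w Cu Cw|i _].
  by rewrite -[u]scale1r CL.
rewrite -[_ *: _]addr0; apply: CL => //.
by rewrite -mem_enum; apply: mem_nth; rewrite -cardE.
Qed.

(** Multiplication by g is a bijection from the polynomials of size at most n - t onto these
    multiples. *)
Lemma card_multiples (F : finFieldType) (g : {poly F}) t n :
  size g = t.+1 -> (t <= n)%N ->
  #|[set c : 'rV[F]_n | g %| rVpoly c]| = (#|F| ^ (n - t))%N.
Proof.
move=> size_g le_tn; have g0 : g != 0 by rewrite -size_poly_gt0 size_g.
pose f (q : 'rV[F]_(n - t)) : 'rV[F]_n := poly_rV (g * rVpoly q).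
have size_f (q : 'rV[F]_(n - t)) : (size (g * rVpoly q)%R <= n)%N.
  apply: leq_trans (size_polyMleq _ _) _.
  by rewrite size_g addSn /= -leq_subRL // size_poly.
have f_inj : injective f.
  move=> q1 q2 /(congr1 rVpoly); rewrite !poly_rV_K // => /(mulfI g0).
  exact: (can_inj rVpolyK).
rewrite -[(n - t)%N in RHS]mul1n -card_mx -(card_imset _ f_inj).
apply: eq_card => c; rewrite !inE; apply/idP/imsetP => [/dvdpP[q cE]|[q _ ->]].
  exists (poly_rV q) => //; rewrite /f poly_rV_K; first by rewrite mulrC -cE rVpolyK.
  have [->|q0] := eqVneq q 0; first by rewrite size_poly0.
  have : (size (rVpoly c) <= n)%N by apply: size_poly.
  by rewrite cE size_mul // size_g addnS /= addnC leq_subRL.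
by rewrite poly_rV_K // dvdp_mulr.
Qed.

(** * Descent of the generator polynomial to F_3, dimension and minimum distance *)

Section TernaryCode.

Variables (L : finFieldType) (m : nat) (alpha : L).
Hypotheses (card_L : #|L| = (3 ^ m)%N) (m_gt0 : (0 < m)%N).
Hypothesis prim_alpha : (3 ^ m - 1).-primitive_root alpha.

Let pchar3 : 3 \in [pchar L] := card_finPcharP card_L isT.

Lemma F3_to_morphism : exists f : {rmorphism 'F_3 -> L}, f =1 F3_to L.
Proof.
have natM k : (k %% 3)%:R = k%:R :> L := GRing.natr_mod_pchar pchar3 k.
have fB : zmod_morphism (F3_to L).
  move=> a b; apply/eqP; rewrite eq_sym subr_eq eq_sym -natrD -natM.
  by rewrite -[in X in _ == X](subrK b a) /F3_to /= natM.
have fM : monoid_morphism (F3_to L).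
  by split=> // a b; rewrite /F3_to -natrM -[RHS]natM.
pose fA := GRing.isZmodMorphism.Build _ _ _ fB.
pose fR := GRing.isMonoidMorphism.Build _ _ _ fM.
pose f : {rmorphism 'F_3 -> L} := HB.pack (F3_to L) fA fR.
by exists f.
Qed.

(** In characteristic 3, x^3 - x = x (x - 1) (x - 2). *)
Lemma F3_to_fixed (x : L) : x ^+ 3 = x -> exists a, F3_to L a = x.
Proof.
move=> x3; have : x * (x - 1) * (x - 2) = 0.
  have e3 : 3 = 0 :> L by apply: pcharf0.
  suff -> : x * (x - 1) * (x - 2) = x ^+ 3 - x - 3 * (x ^+ 2 - x).
    by rewrite e3 mul0r x3 subrr subr0.
  ring.
move/eqP; rewrite !mulf_eq0 !subr_eq0 => /orP[/orP[]|] /eqP->.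
- by exists 0.
- by exists 1.
- by exists (1 + 1).
Qed.

(* The Frobenius map permutes the roots by j |-> 3 j mod n, a cyclic shift of the
   base 3 digits. *)
Lemma gen_poly_Frobenius i :
  (gen_poly alpha 0 3 m)`_i ^+ 3 = (gen_poly alpha 0 3 m)`_i.
Proof.
rewrite -(pFrobenius_autE pchar3) -coef_map.
suff -> : map_poly (pFrobenius_aut pchar3) (gen_poly alpha 0 3 m)
          = gen_poly alpha 0 3 m by [].
rewrite /gen_poly rmorph_prod /=.
pose s j := (3 * j %% (3 ^ m - 1))%N.
rewrite (eq_bigr (fun j => 'X - (alpha ^+ s j)%:P)) => [|j _]; last first.
  rewrite rmorphB /= map_polyX map_polyC /= pFrobenius_autE -exprM mulnC.
  by rewrite (prim_expr_mod prim_alpha).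
have X3 : (3 <= 3 ^ m)%N by rewrite -{1}[3%N]expn1 leq_exp2l.
have cop3 : coprime (3 ^ m - 1) 3.
  rewrite coprime_sym prime_coprime //.
  by rewrite -(prednK m_gt0) expnS; lia.
have uT : uniq (Tset 0 3 m) by rewrite filter_uniq // iota_uniq.
rewrite -(big_map s xpredT (fun j => 'X - (alpha ^+ j)%:P)).
have uST : uniq (map s (Tset 0 3 m)).
  rewrite map_inj_in_uniq // => j k.
  rewrite !mem_Tset => /andP[/andP[_ ltj] _] /andP[/andP[_ ltk] _] /eqP.
  rewrite /s -(eq_prim_root_expr prim_alpha) ![(3 * _)%N]mulnC !exprM.
  rewrite -!(pFrobenius_autE pchar3) (inj_eq (fmorph_inj _)).
  by rewrite (eq_prim_root_expr prim_alpha) !modn_small // => /eqP.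
apply: perm_big; apply: uniq_perm => // j.
(* Since [s] is injective on T, it permutes T once it maps T into itself. *)
apply: (uniq_min_size uST _ _).2; last by rewrite size_map.
move=> _ /mapP[k Tk ->]; move: Tk; rewrite !mem_Tset /s => /andP[/andP[k0 ltk] wk].
rewrite ltn_mod lt0n -[(_ == 0)%N]/(dvdn _ _) Gauss_dvdr // gtnNdvd //.
rewrite subn_gt0 (leq_trans _ X3) //=.
by rewrite /w03 -(prednK m_gt0) w3_rot ?prednK.
Qed.

Lemma gen_poly_F3 : exists2 g0 : {poly 'F_3},
  map_poly (F3_to L) g0 = gen_poly alpha 0 3 m & size g0 = (size (Tset 0 3 m)).+1.
Proof.
have [f fE] := F3_to_morphism.
have ex i : exists a, F3_to L a == (gen_poly alpha 0 3 m)`_i.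
  by have [a <-] := F3_to_fixed (gen_poly_Frobenius i); exists a.
pose g0 := \poly_(i < size (gen_poly alpha 0 3 m)) xchoose (ex i).
have e : map_poly (F3_to L) g0 = gen_poly alpha 0 3 m.
  rewrite -(eq_map_poly fE); apply/polyP => i; rewrite coef_map /= fE coef_poly.
  case: ltnP => [_|le]; first exact/eqP/(xchooseP (ex i)).
  by rewrite nth_default.
exists g0 => //.
by rewrite -(size_map_poly f) (eq_map_poly fE) e size_prod_XsubC.
Qed.

Lemma word_polyE n (c : 'rV['F_3]_n) : word_poly L c = map_poly (F3_to L) (rVpoly c).
Proof.
have [f fE] := F3_to_morphism.
rewrite -(eq_map_poly fE); apply/polyP => i; rewrite coef_map /= fE coef_rVpoly.
rewrite /word_poly coef_sum; case: insubP => [j _ <-|ni].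
  rewrite (bigD1 j) //= big1 => [|k nk]; rewrite coefZ coefXn ?eqxx ?mulr1 ?addr0 //.
  by rewrite eq_sym (inj_eq val_inj) (negPf nk) mulr0.
rewrite big1 => [|k _]; first by rewrite /F3_to.
rewrite coefZ coefXn; case: eqP => [e|]; last by rewrite mulr0.
by rewrite e ltn_ord in ni.
Qed.

(** Divisibility is unchanged by field extension, so the code consists of the multiples of g over
    F_3; counting them gives 3^k. *)
Lemma code_dim_cyc_code :
  code_dim (cyc_code alpha 0 3 m) = (3 ^ m - 1 - size (Tset 0 3 m))%N.
Proof.
have [f fE] := F3_to_morphism; have [g gE size_g] := gen_poly_F3.
have CE : cyc_code alpha 0 3 m = [set c | g %| rVpoly c].
  apply/setP => c; rewrite !inE word_polyE -gE -!(eq_map_poly fE).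
  exact: dvdp_map.
have le_T : (size (Tset 0 3 m) <= 3 ^ m - 1)%N.
  rewrite size_filter (leq_trans (count_size _ _)) // size_iota.
  by rewrite leq_sub2l.
rewrite /code_dim CE; apply/eqP.
rewrite -(eqn_exp2l (m := 3)) // -[X in (X ^ \dim _)%N](card_Fp (p := 3)) //.
rewrite -card_vspace card_span.
- by rewrite (card_multiples size_g le_T) card_Fp.
- by rewrite inE linear0 dvdp0.
- move=> a u v; rewrite !inE => du dv.
  by rewrite linearP /= dvdp_add // -mul_polyC dvdp_mull.
Qed.

(** As v is prime to n, [alpha ^+ v] is again a primitive n-th root of unity, and codewords vanish
    at its powers 1 to d. *)
Lemma min_dist_cyc_code v d : coprime v (3 ^ m - 1) -> (d < 3 ^ m - 1)%N ->
  (forall i, 0 < i <= d -> v * i %% (3 ^ m - 1) \in Tset 0 3 m)%N ->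
  (d < min_dist (cyc_code alpha 0 3 m))%N.
Proof.
move=> cop lt_dn runT; have [f fE] := F3_to_morphism.
(* The default value n of the minimum exceeds d by [lt_dn]. *)
rewrite /min_dist; elim/big_ind: _ => // [x y dx dy|c /andP[]].
  by rewrite leq_min dx dy.
rewrite inE => /dvdpP[q cE] c0.
have wtE : wt c = #|[set k | F3_to L (c 0 k) != 0]|.
  by apply: eq_card => k; rewrite !inE -fE fmorph_eq0.
rewrite wtE; apply: (@bch_bound _ _ _ (alpha ^+ v)) => [|i rng_i|].
- by rewrite (prim_root_exp_coprime _ prim_alpha).
- have : root (word_poly L c) (alpha ^+ (v * i)).
    rewrite cE rootM; apply/orP; right.
    rewrite /gen_poly -(big_map (fun j => alpha ^+ j) xpredT (fun z => 'X - z%:P)).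
    rewrite root_prod_XsubC -(prim_expr_mod prim_alpha).
    by apply: map_f; apply: runT.
  rewrite /word_poly => /rootP; rewrite horner_sum => root_c.
  rewrite -[RHS]root_c; apply: eq_bigr => k _.
  by rewrite hornerZ hornerXn -!exprM mulnA.
- have /rV0Pn[k ck] := c0.
  by exists k; rewrite -fE fmorph_eq0.
Qed.

End TernaryCode.

Theorem theorem3 (L : finFieldType) (m : nat) (alpha : L) :
  (5 <= m)%N -> odd m -> #|L| = (3 ^ m)%N ->
  (3 ^ m - 1).-primitive_root alpha ->
  let n := (3 ^ m - 1)%N in
  let C := cyc_code alpha 0 3 m in
  ((m %% 4)%N = 3%N ->
     ((3 ^ ((m - 1) %/ 2) + 7) %/ 2 <= min_dist C)%N /\ code_dim C = (n %/ 2)%N) /\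
  ((m %% 4)%N = 1%N ->
     ((3 ^ ((m - 1) %/ 2) + 5) %/ 2 <= min_dist C)%N /\ code_dim C = ((n + 2) %/ 2)%N).
Proof.
move=> m5 om cardL prim n C.
have m0 : (0 < m)%N by lia.
have [h mE] : exists h, m = h.*2.+1 by exists m./2; lia.
have hE : ((m - 1) %/ 2 = h)%N by lia.
have X9 : (9 <= 3 ^ h)%N by rewrite -[9%N]/(3 ^ 2)%N leq_exp2l //; lia.
have le_Xn : (3 ^ h * 9 <= 3 ^ m)%N.
  by rewrite mE expnS -addnn expnD mulnCA leq_mul2l; lia.
have TE := size_Tset_mod4 (m %/ 4) (r := m %% 4).
have mdE : (4 * (m %/ 4) + m %% 4 = m)%N by lia.
rewrite mdE in TE; rewrite hE.
split=> mr; rewrite mr /= in TE; (split; last first).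
- by rewrite code_dim_cyc_code // /n; have := TE (or_intror erefl); lia.
(* A run of (3^h + 5)/2 zeros; the strict BCH bound adds one. *)
- have [|//|] := @run_mod4_3 h; [lia | lia |].
  rewrite -mE => cop runT.
  have := min_dist_cyc_code cardL prim cop _ runT; rewrite -/C => lt_d.
  by apply: leq_trans (lt_d _); lia.
- by rewrite code_dim_cyc_code // /n; have := TE (or_introl erefl); lia.
- have [|//|] := @run_mod4_1 h; [lia | lia |].
  rewrite -mE => cop runT.
  have := min_dist_cyc_code cardL prim cop _ runT; rewrite -/C => lt_d.
  by apply: leq_trans (lt_d _); lia.
Qed.
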